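(* Let $\{\phi_k\}_{k=0}^{\infty}$ be a complete orthonormal system of real-valued functions on $[a,b]$ with $\phi_0=\frac{1}{\|1\|}$ (a constant function), and let $X,Y$ be two random variables with values in $[a,b]$ whose joint probability density function has the expansion $f(x,y)=\sum_{j,k=0}^{\infty} c_{j,k}\,\phi_j(x)\phi_k(y)$. Then $X$ and $Y$ are independent if and only if the expansion coefficient matrix $C=[c_{j,k}]_{j,k\ge 0}$ is a rank-1 matrix $C=[h_0,h_1,\dots]^T[g_0,g_1,\dots]$, that is, there exist real sequences $(h_j)_{j\ge0}$ and $(g_k)_{k\ge0}$ with $c_{j,k}=h_j g_k$ for all $j,k\ge 0$.
   Context: Orthonormality and completeness are with respect to $\langle u,v\rangle=\int_a^b u(x)v(x)\,dx$ on $L^2([a,b])$, and $\|\cdot\|$ is the associated norm. Saying that $f$ has the stated expansion means that $f\in L^2([a,b]^2)$ and the series converges to $f$ in $L^2([a,b]^2)$. *)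

(* Defs.v *)
From HB Require Import structures.
From mathcomp Require Import all_boot all_order all_algebra.
From mathcomp Require Import all_classical all_reals all_analysis.

Set Implicit Arguments.
Unset Strict Implicit.
Unset Printing Implicit Defensive.

Import Order.TTheory GRing.Theory Num.Theory.
Import numFieldNormedType.Exports.

Local Open Scope classical_set_scope.
Local Open Scope ring_scope.

Section L2.
Context {d : measure_display} {T : measurableType d} {R : realType}.
Variables (mu : {measure set T -> \bar R}) (D : set T).

(* Functions on D are total functions on T whose values outside D are
   irrelevant; [u \_ D] extends the restriction of u to D by 0. *)
Definition L2on (u : T -> R) : Prop := (u \_ D) \in Lfun mu 2%:E.

Definition inner (u v : T -> R) : R := \int[mu]_(x in D) (u x * v x).

Definition L2norm (u : T -> R) : R := Num.sqrt (inner u u).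

Definition orthonormal_system (phi : nat -> T -> R) : Prop :=
  (forall k, L2on (phi k)) /\
  (forall j k, inner (phi j) (phi k) = (j == k)%:R).

(* Completeness: the only element of L2 orthogonal to every phi k is 0. *)
Definition complete_system (phi : nat -> T -> R) : Prop :=
  forall u, L2on u -> (forall k, inner u (phi k) = 0) ->
    {ae mu, forall x, D x -> u x = 0}.

End L2.

Section expansion.
Context {R : realType}.

Definition square (a b : R) : set (R * R) := `[a, b] `*` `[a, b].

(* lebesgue_measure lives on measurableTypeR R, an alias of R with convertible
   measurable sets but another display, hence the type ascription. *)
Definition lebesgue2 :
    {measure set (measurableTypeR R * measurableTypeR R) -> \bar R} :=
  (@lebesgue_measure R \x @lebesgue_measure R)%E.

Definition partial_sum (phi : nat -> R -> R) (c : nat -> nat -> R)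
    (m n : nat) (z : R * R) : R :=
  \sum_(j < m) \sum_(k < n) c j k * (phi j z.1 * phi k z.2).

(* The double series is the limit of its rectangular partial sums as both
   bounds tend to infinity independently.  For orthonormal phi this agrees with
   the other usual modes of summation (square partial sums, unordered sums). *)
Definition has_expansion (a b : R) (phi : nat -> R -> R)
    (c : nat -> nat -> R) (f : R * R -> R) : Prop :=
  L2on lebesgue2 (square a b) f /\
  (fun mn : nat * nat =>
     L2norm lebesgue2 (square a b) (f \- partial_sum phi c mn.1 mn.2))
    @ filter_prod \oo \oo --> (0 : R).

End expansion.

Section random_variables.
Context {d : measure_display} {T : measurableType d} {R : realType}.
Variable P : probability T R.

Definition joint_density (a b : R) (X Y : {RV P >-> R}) (f : R * R -> R) :
    Prop :=
  [/\ measurable_fun (square a b) f,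
      (forall z, square a b z -> 0 <= f z) &
      forall A : set (R * R), measurable A ->
        P [set w | A (X w, Y w)] =
        (\int[lebesgue2]_(z in A `&` square a b) (f z)%:E)%E].

Definition independent_RV (X Y : {RV P >-> R}) : Prop :=
  forall A B : set R, measurable A -> measurable B ->
    P (X @^-1` A `&` Y @^-1` B) = (P (X @^-1` A) * P (Y @^-1` B))%E.

End random_variables.

(* Main.v *)
From HB Require Import structures.
Require Import Defs.
From mathcomp Require Import all_boot all_order all_algebra.
From mathcomp Require Import all_classical all_reals all_analysis.
From mathcomp Require Import measurable_realfun.

Set Implicit Arguments.
Unset Strict Implicit.
Unset Printing Implicit Defensive.

Import Order.TTheory GRing.Theory Num.Theory.
Import numFieldNormedType.Exports.

Local Open Scope classical_set_scope.
Local Open Scope ring_scope.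

(* By Cauchy-Schwarz, L2 convergence of the expansion gives, for u, v in L2,
   B(u, v) := <f, u (x) v> = lim_(m,n) S_m(u) T_n(v), where in general the
   right-hand side is \sum_(j < m, k < n) c_jk <phi_j, u> <phi_k, v>, and it
   factors as written when c_jk = h_j g_k.

   Hence c_jk = B(phi_j, phi_k) = E[phi_j(X) phi_k(Y)], which under
   independence is E[phi_j(X)] E[phi_k(Y)]: the matrix has rank one.

   Conversely, if c_jk = h_j g_k, then taking limits in
   S_m(u) T_n(v) * S_m(u') T_n(v') = S_m(u) T_n(v') * S_m(u') T_n(v)
   gives B(u, v) B(u', v') = B(u, v') B(u', v).  For u = 1_A, v = 1_B and
   u' = v' = 1 this reads P(X in A, Y in B) = P(X in A) P(Y in B). *)

(** * Square-integrable functions and the Cauchy-Schwarz inequality *)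

Section L2_space.
Context {d : measure_display} {T : measurableType d} {R : realType}.
Variable mu : {measure set T -> \bar R}.
Implicit Types u v w : T -> R.

Lemma Lfun_measurable p u : u \in Lfun mu p -> measurable_fun setT u.
Proof. by rewrite inE => /andP[/set_mem]. Qed.

Lemma integrable_sqr_Lfun2 u : measurable_fun setT u ->
  mu.-integrable setT (EFin \o (fun x => u x ^+ 2)) -> u \in Lfun mu 2%:E.
Proof.
move=> mu_ /integrableP[_ iu]; rewrite inE; apply/andP; split; rewrite inE//=.
rewrite /finite_norm unlock poweR_lty//=.
apply: le_lt_trans iu; rewrite le_eqVlt; apply/orP; left; apply/eqP.
apply: eq_integral => x _ /=.
by rewrite powR_mulrn// normrX.
Qed.

Lemma Lfun2D u v : u \in Lfun mu 2%:E -> v \in Lfun mu 2%:E ->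
  u \+ v \in Lfun mu 2%:E.
Proof. by case: (Lfun_addr_closed mu (lee1n 2)) => _; apply. Qed.

Lemma Lfun2_integrableM u v : u \in Lfun mu 2%:E -> v \in Lfun mu 2%:E ->
  mu.-integrable setT (EFin \o (u \* v)).
Proof. by move=> Lu Lv; apply/Lfun1_integrable/Lfun2_mul_Lfun1. Qed.

(** Bridge between the extended-real norm, about which Hölder's inequality speaks, and the real
    number [L2norm]. The integral of the square is finite, so [fine] loses nothing. *)
Lemma fine_Lnorm2 u : u \in Lfun mu 2%:E ->
  'N[mu]_2%:E[EFin \o u]%E = (L2norm mu setT u)%:E.
Proof.
move=> Lu; have := Lfun2_integrable_sqr Lu => iu.
rewrite unlock /L2norm /inner /Rintegral -powR12_sqrt; last first.
  apply: fine_ge0; apply: integral_ge0 => x _.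
  by rewrite lee_fin -expr2 sqr_ge0.
rewrite -poweR_EFin fineK; last exact: integrable_fin_num.
congr poweR; apply: eq_integral => x _ /=.
by rewrite powR_mulrn// real_normK// num_real.
Qed.

(** Hölder's inequality with both exponents equal to 2, after moving the absolute value inside the
    integral. *)
Lemma Cauchy_Schwarz u v : u \in Lfun mu 2%:E -> v \in Lfun mu 2%:E ->
  `|inner mu setT u v| <= L2norm mu setT u * L2norm mu setT v.
Proof.
move=> Lu Lv; rewrite -lee_fin EFinM -!fine_Lnorm2//.
have iuv := Lfun2_integrableM Lu Lv.
have [mfu mfv] := (Lfun_measurable Lu, Lfun_measurable Lv).
apply: le_trans (hoelder mu mfu mfv _ _ _) => //.
  rewrite EFin_normr_Rintegral// Lnorm1; apply: le_abse_integral => //.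
  exact: (measurable_int mu).
by rewrite [RHS]splitr !div1r.
Qed.

Lemma innerBl u v w : u \in Lfun mu 2%:E -> v \in Lfun mu 2%:E ->
  w \in Lfun mu 2%:E ->
  inner mu setT (u \- v) w = inner mu setT u w - inner mu setT v w.
Proof.
move=> Lu Lv Lw; rewrite -RintegralB//; try exact: Lfun2_integrableM.
by apply: eq_Rintegral => x _; rewrite /= mulrBl.
Qed.

(** Extension by zero moves everything to the whole space, so that the Hilbert space arguments need
    not carry a domain. *)
Lemma inner_restrict D u v :
  inner mu D u v = inner mu setT (u \_ D) (v \_ D).
Proof.
rewrite /inner Rintegral_mkcond; apply: eq_Rintegral => x _.
by rewrite !patchE; case: ifP => //; rewrite mul0r.
Qed.

Lemma L2norm_restrict D u : L2norm mu D u = L2norm mu setT (u \_ D).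
Proof. by rewrite /L2norm inner_restrict. Qed.

End L2_space.

(** * Tensor products of functions and Fubini's theorem *)

Section tensor.
Context {d1 d2 : measure_display} {T1 : measurableType d1}
  {T2 : measurableType d2} {R : realType}.

Definition tensor (u : T1 -> R) (v : T2 -> R) (z : T1 * T2) : R :=
  u z.1 * v z.2.

Lemma measurable_tensor u v : measurable_fun setT u -> measurable_fun setT v ->
  measurable_fun setT (tensor u v).
Proof.
move=> mu mv; apply: measurable_funM.
  exact: measurableT_comp mu measurable_fst.
exact: measurableT_comp mv measurable_snd.
Qed.

Variables (m1 : {sigma_finite_measure set T1 -> \bar R})
          (m2 : {sigma_finite_measure set T2 -> \bar R}).

(** By Tonelli it suffices to bound the iterated integral of the absolute value, which splits into a
    product of two finite integrals. *)
Lemma integrable_tensor u v :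
  m1.-integrable setT (EFin \o u) -> m2.-integrable setT (EFin \o v) ->
  (m1 \x m2)%E.-integrable setT (EFin \o tensor u v).
Proof.
move=> iu iv.
have mu : measurable_fun setT u by apply/measurable_EFinP/(measurable_int m1).
have mv : measurable_fun setT v by apply/measurable_EFinP/(measurable_int m2).
apply/integrable12ltyP.
  by apply/measurable_EFinP; exact: measurable_tensor.
have /integrableP[_ iv'] := iv; have /integrableP[_ iu'] := iu.
rewrite [ltLHS](_ : _ =
    (\int[m1]_x `|(u x)%:E| * \int[m2]_y `|(v y)%:E|)%E); last first.
  rewrite -ge0_integralZr//; last 2 first.
  - by apply/measurable_EFinP; apply: measurableT_comp.
  - exact: integral_ge0.
  apply: eq_integral => x _; rewrite -ge0_integralZl//; last first.
    by apply/measurable_EFinP; apply: measurableT_comp.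
  by apply: eq_integral => y _; rewrite /tensor /= normrM EFinM.
by rewrite lte_mul_pinfty ?ge0_fin_numE ?integral_ge0.
Qed.

Lemma Rintegral_tensor u v :
  m1.-integrable setT (EFin \o u) -> m2.-integrable setT (EFin \o v) ->
  \int[(m1 \x m2)%E]_z tensor u v z = \int[m1]_x u x * \int[m2]_y v y.
Proof.
move=> iu iv; rewrite /Rintegral -fineM; try exact: integrable_fin_num.
congr fine; rewrite -integral12_prod_meas1; last exact: integrable_tensor.
rewrite -(fineK (integrable_fin_num measurableT iv)) -integralZr//.
apply: eq_integral => x _; rewrite /fubini_F /tensor /=.
rewrite fineK; last exact: integrable_fin_num.
by rewrite -integralZl//; apply: eq_integral => y _; rewrite EFinM.
Qed.

(** The square of a tensor is the tensor of the squares, which are integrable. *)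
Lemma Lfun2_tensor u v : u \in Lfun m1 2%:E -> v \in Lfun m2 2%:E ->
  tensor u v \in Lfun (m1 \x m2)%E 2%:E.
Proof.
move=> Lu Lv; apply: integrable_sqr_Lfun2.
  apply: measurable_tensor; first exact: Lfun_measurable Lu.
  exact: Lfun_measurable Lv.
have := integrable_tensor (Lfun2_integrable_sqr Lu) (Lfun2_integrable_sqr Lv).
by apply: eq_integrable => // z _; rewrite /tensor /= exprMn.
Qed.

Lemma inner_tensor u v u' v' :
  u \in Lfun m1 2%:E -> v \in Lfun m2 2%:E ->
  u' \in Lfun m1 2%:E -> v' \in Lfun m2 2%:E ->
  inner (m1 \x m2)%E setT (tensor u v) (tensor u' v') =
  inner m1 setT u u' * inner m2 setT v v'.
Proof.
move=> Lu Lv Lu' Lv'; rewrite /inner -Rintegral_tensor;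
  try exact: Lfun2_integrableM.
by apply: eq_Rintegral => z _; rewrite /tensor mulrACA.
Qed.

End tensor.

(** * Linearity and continuity of the inner product *)

Section L2_limits.
Context {d : measure_display} {T : measurableType d} {R : realType}.
Variable mu : {measure set T -> \bar R}.
Implicit Types u v w : T -> R.

Lemma Lfun2B u v : u \in Lfun mu 2%:E -> v \in Lfun mu 2%:E ->
  u \- v \in Lfun mu 2%:E.
Proof.
move=> Lu Lv; apply: (@Lfun2D _ _ _ mu u (- v)) => //.
exact: Lfun_oppr_closed.
Qed.

Lemma Lfun2Z (k : R) u : u \in Lfun mu 2%:E ->
  (fun x => k * u x) \in Lfun mu 2%:E.
Proof.
move=> Lu; rewrite (_ : (fun x => k * u x) = k \o* u).
  by apply: Lfun_scale => //; rewrite ler1n.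
by apply/funext => x /=; rewrite mulrC.
Qed.

Lemma Lfun2_sum n (G : nat -> T -> R) :
  (forall j, G j \in Lfun mu 2%:E) ->
  (fun x => \sum_(j < n) G j x) \in Lfun mu 2%:E.
Proof.
move=> LG; elim: n => [|n IHn].
  rewrite (_ : (fun _ => _) = cst 0); last first.
    by apply/funext => x; rewrite big_ord0.
  by case: (Lfun_addr_closed mu (lee1n 2)).
rewrite (_ : (fun _ => _) = (fun x => \sum_(j < n) G j x) \+ G n); last first.
  by apply/funext => x; rewrite big_ord_recr.
exact: Lfun2D.
Qed.

Lemma innerZl (k : R) u w : u \in Lfun mu 2%:E -> w \in Lfun mu 2%:E ->
  inner mu setT (fun x => k * u x) w = k * inner mu setT u w.
Proof.
move=> Lu Lw; rewrite /inner -RintegralZl//; last exact: Lfun2_integrableM.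
by apply: eq_Rintegral => x _; rewrite mulrA.
Qed.

Lemma inner_suml n (G : nat -> T -> R) w :
  (forall j, G j \in Lfun mu 2%:E) -> w \in Lfun mu 2%:E ->
  inner mu setT (fun x => \sum_(j < n) G j x) w =
  \sum_(j < n) inner mu setT (G j) w.
Proof.
move=> LG Lw; elim: n => [|n IHn].
  rewrite big_ord0 /inner; under eq_Rintegral do rewrite big_ord0 mul0r.
  by rewrite /Rintegral integral0.
rewrite big_ord_recr /= -IHn /inner -RintegralD//;
  try by apply: Lfun2_integrableM => //; exact: Lfun2_sum.
by apply: eq_Rintegral => x _; rewrite big_ord_recr /= mulrDl.
Qed.

(** Cauchy-Schwarz squeezes the error [inner (u - G i) w] to 0. The filter is arbitrary because the
    double series converges along [filter_prod \oo \oo]. *)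
Lemma cvg_innerl {I : Type} (Fl : set_system I) {FF : Filter Fl}
    (G : I -> T -> R) u w :
  u \in Lfun mu 2%:E -> (forall i, G i \in Lfun mu 2%:E) ->
  w \in Lfun mu 2%:E ->
  L2norm mu setT (u \- G i) @[i --> Fl] --> (0 : R) ->
  inner mu setT (G i) w @[i --> Fl] --> inner mu setT u w.
Proof.
move=> Lu LG Lw uG.
have -> : (fun i => inner mu setT (G i) w) =
    (fun i => inner mu setT u w - inner mu setT (u \- G i) w).
  by apply/funext => i; rewrite innerBl// subKr.
rewrite -[X in _ --> X]subr0; apply: cvgB; first exact: cvg_cst.
apply: norm_cvg0.
apply: (@squeeze_cvgr _ _ _ _ (fun=> 0)
  (fun i => L2norm mu setT (u \- G i) * L2norm mu setT w)).
- by apply: nearW => i; rewrite normr_ge0 Cauchy_Schwarz//; exact: Lfun2B.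
- exact: cvg_cst.
- by rewrite -(mul0r (L2norm mu setT w)); apply: cvgMr_tmp.
Qed.

End L2_limits.

(** * Double expansions tested against tensors *)

Section tensor_expansion.
Context {d : measure_display} {T : measurableType d} {R : realType}.
Variables (mu : {sigma_finite_measure set T -> \bar R}) (psi : nat -> T -> R)
  (c : nat -> nat -> R).
Hypothesis Lpsi : forall k, psi k \in Lfun mu 2%:E.

Definition tensor_sum m n (z : T * T) : R :=
  \sum_(j < m) \sum_(k < n) c j k * tensor (psi j) (psi k) z.

Lemma Lfun2_tensor_sum m n : tensor_sum m n \in Lfun (mu \x mu)%E 2%:E.
Proof.
have Ljk j k : (fun z => c j k * tensor (psi j) (psi k) z)
    \in Lfun (mu \x mu)%E 2%:E by exact/Lfun2Z/Lfun2_tensor.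
pose G j z := \sum_(k < n) c j k * tensor (psi j) (psi k) z.
by apply: (@Lfun2_sum _ _ _ _ m G) => j; exact: Lfun2_sum (Ljk j).
Qed.

Lemma inner_tensor_sum m n u v : u \in Lfun mu 2%:E -> v \in Lfun mu 2%:E ->
  inner (mu \x mu)%E setT (tensor_sum m n) (tensor u v) =
  \sum_(j < m) \sum_(k < n)
    c j k * (inner mu setT (psi j) u * inner mu setT (psi k) v).
Proof.
move=> Lu Lv.
have Lt j k : (fun z => c j k * tensor (psi j) (psi k) z)
    \in Lfun (mu \x mu)%E 2%:E by exact/Lfun2Z/Lfun2_tensor.
have Luv := Lfun2_tensor Lu Lv.
pose G j z := \sum_(k < n) c j k * tensor (psi j) (psi k) z.
rewrite (@inner_suml _ _ _ _ m G)//; last by move=> j; exact: Lfun2_sum (Lt j).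
apply: eq_bigr => j _; rewrite (inner_suml n (Lt j))//.
apply: eq_bigr => k _.
by rewrite innerZl ?inner_tensor//; exact: Lfun2_tensor.
Qed.

Variable F : T * T -> R.
Hypothesis LF : F \in Lfun (mu \x mu)%E 2%:E.
Hypothesis Fexp : L2norm (mu \x mu)%E setT (F \- tensor_sum mn.1 mn.2)
  @[mn --> filter_prod \oo \oo] --> (0 : R).

Lemma cvg_inner_tensor u v : u \in Lfun mu 2%:E -> v \in Lfun mu 2%:E ->
  \sum_(j < mn.1) \sum_(k < mn.2)
    c j k * (inner mu setT (psi j) u * inner mu setT (psi k) v)
  @[mn --> filter_prod \oo \oo] --> inner (mu \x mu)%E setT F (tensor u v).
Proof.
move=> Lu Lv; under eq_fun do rewrite -inner_tensor_sum//.
apply: (@cvg_innerl _ _ _ _ _ _ _ (fun mn => tensor_sum mn.1 mn.2)) => //.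
- by move=> mn; exact: Lfun2_tensor_sum.
- exact: Lfun2_tensor.
Qed.

(** Orthonormality leaves a single term of the partial sum tested against [tensor (psi j) (psi k)],
    so it is constantly [c j k] once [m > j] and [n > k]; uniqueness of limits concludes. *)
Lemma expansion_coef :
  (forall j k, inner mu setT (psi j) (psi k) = (j == k)%:R) ->
  forall j k, c j k = inner (mu \x mu)%E setT F (tensor (psi j) (psi k)).
Proof.
move=> psi_on j k; apply/esym.
have := cvg_inner_tensor (Lpsi j) (Lpsi k).
have : (fun mn : nat * nat => \sum_(i < mn.1) \sum_(l < mn.2) c i l *
    (inner mu setT (psi i) (psi j) * inner mu setT (psi l) (psi k)))
    @ filter_prod \oo \oo --> c j k.
  apply: cvg_near_cst.
  exists ([set m | (j < m)%N], [set n | (k < n)%N]).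
    by split; [exists j.+1|exists k.+1].
  move=> [m n] /= [jm kn]; apply/eqP.
  rewrite (bigD1 (Ordinal jm))//= (bigD1 (Ordinal kn))//= !psi_on !eqxx !mulr1.
  rewrite !big1 ?addr0// => [i ij|l lk].
    rewrite big1// => l _; rewrite psi_on (_ : (_ == _) = false).
      by rewrite mul0r mulr0.
    exact: negbTE ij.
  by rewrite psi_on (_ : (_ == _) = false) ?mulr0//; apply: negbTE lk.
by move=> /[swap]; exact: cvg_unique.
Qed.

(** At finite stages the form factors as [s x m * t y n], so both sides are rearrangements of the
    same four factors. Only the products [s * t] are known to converge, so the rearrangement is made
    before the limit is taken. *)
Lemma rank1_inner_tensor (h g : nat -> R) u v u' v' :
  (forall j k, c j k = h j * g k) ->
  u \in Lfun mu 2%:E -> v \in Lfun mu 2%:E ->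
  u' \in Lfun mu 2%:E -> v' \in Lfun mu 2%:E ->
  let B x y := inner (mu \x mu)%E setT F (tensor x y) in
  B u v * B u' v' = B u v' * B u' v.
Proof.
move=> chg Lu Lv Lu' Lv' B.
pose s x m := \sum_(j < m) h j * inner mu setT (psi j) x.
pose t x m := \sum_(j < m) g j * inner mu setT (psi j) x.
have cB x y : x \in Lfun mu 2%:E -> y \in Lfun mu 2%:E ->
    s x mn.1 * t y mn.2 @[mn --> filter_prod \oo \oo] --> B x y.
  move=> Lx Ly; have := cvg_inner_tensor Lx Ly; apply: cvg_trans.
  apply: near_eq_cvg; apply: nearW => mn; rewrite /s /t mulr_suml.
  apply: eq_bigr => j _; rewrite mulr_sumr.
  by apply: eq_bigr => k _; rewrite chg mulrACA.
(* Exchanging the two [t] factors is the vanishing of a 2 by 2 minor. *)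
have st : (fun mn : nat * nat => s u mn.1 * t v mn.2 * (s u' mn.1 * t v' mn.2))
    = (fun mn => s u mn.1 * t v' mn.2 * (s u' mn.1 * t v mn.2)).
  by apply/funext => mn; rewrite mulrACA (mulrC (t v _)) mulrACA.
have cl : s u mn.1 * t v mn.2 * (s u' mn.1 * t v' mn.2)
    @[mn --> filter_prod \oo \oo] --> B u v * B u' v'.
  by apply: cvgM; exact: cB.
rewrite st in cl; apply: cvg_unique cl _ => //.
by apply: cvgM; exact: cB.
Qed.

End tensor_expansion.

(** * Sigma-finiteness of a product measure *)

Section sigma_finite_product.
Context {d1 d2 : measure_display} {T1 : measurableType d1}
  {T2 : measurableType d2} {R : realType}.
Variables (m1 : {sigma_finite_measure set T1 -> \bar R})
          (m2 : {sigma_finite_measure set T2 -> \bar R}).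

(* The library's canonical structures on [m1 \x m2] beyond [measure] apply only
   to subprobabilities, hence this alias for the sigma-finite case. *)
Definition sigma_product : set (T1 * T2) -> \bar R := (m1 \x m2)%E.

HB.instance Definition _ := Measure.on sigma_product.

Let sigma_product_sigma_finite : sigma_finite setT sigma_product.
Proof.
have /sigma_finiteP[F [TF ndF Foo]] := sigma_finiteT m1.
have /sigma_finiteP[G [TG ndG Goo]] := sigma_finiteT m2.
exists (fun n => F n `*` G n) => [|n].
  apply/esym/seteqP; split=> // -[x y] _.
  have [i _ Fx] : (\bigcup_i F i) x by rewrite -TF.
  have [j _ Gy] : (\bigcup_j G j) y by rewrite -TG.
  (* Both exhausting sequences increase, so the index [i + j] serves both coordinates. *)
  exists (i + j)%N => //; split.
    by have /subsetPset := ndF _ _ (leq_addr j i); exact.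
  by have /subsetPset := ndG _ _ (leq_addl i j); exact.
have [mF Fn] := Foo n; have [mG Gn] := Goo n; split; first exact: measurableX.
by rewrite /sigma_product product_measure1E// lte_mul_pinfty// ge0_fin_numE.
Qed.

HB.instance Definition _ := Measure_isSigmaFinite.Build _ _ _ sigma_product
  sigma_product_sigma_finite.

End sigma_finite_product.

(** * Integration against a measure given by a density *)

Section density.
Context {d : measure_display} {T : measurableType d} {R : realType}.
Variables (mu : {sigma_finite_measure set T -> \bar R})
  (nu : {finite_measure set T -> \bar R}) (F : T -> R).
Hypothesis mF : measurable_fun setT F.
Hypothesis F0 : forall x, 0 <= F x.
Hypothesis nuE : forall A, measurable A ->
  nu A = (\int[mu]_(x in A) (F x)%:E)%E.

Lemma density_dominates : nu `<< mu.
Proof.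
apply/null_content_dominatesP => A mA muA0; rewrite nuE//.
by apply: null_set_integral => //; exact/measurable_funTS/measurable_EFinP.
Qed.

(** Two densities with the same integral over every measurable set agree almost everywhere. This
    makes the change of variables for the Radon-Nikodym derivative available for [F] itself. *)
Lemma density_ae_eq :
  ae_eq mu setT (Radon_Nikodym_SigmaFinite.f nu mu) (EFin \o F).
Proof.
apply: integral_ae_eq => //.
- exact/Radon_Nikodym_SigmaFinite.f_integrable/density_dominates.
- exact/measurable_EFinP.
- move=> E _ mE; rewrite -nuE//.
  exact/esym/Radon_Nikodym_SigmaFinite.f_integral/mE/density_dominates.
Qed.

Lemma ge0_integral_density (g : T -> \bar R) : (forall x, 0 <= g x)%E ->
  measurable_fun setT g ->
  (\int[nu]_x g x = \int[mu]_x (g x * (F x)%:E))%E.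
Proof.
move=> g0 mg.
rewrite -(Radon_Nikodym_SigmaFinite.change_of_variables density_dominates)//.
have irn := Radon_Nikodym_SigmaFinite.f_integrable density_dominates.
apply: ae_eq_integral => //.
- by apply: emeasurable_funM => //; exact: measurable_int irn.
- by apply: emeasurable_funM => //; exact/measurable_EFinP.
- exact/ae_eqe_mul2l/density_ae_eq.
Qed.

(** As [F] is nonnegative, the absolute value of [F * g] is [F] times that of [g], and the
    nonnegative case applies. *)
Lemma integrable_density (g : T -> R) : measurable_fun setT g ->
  mu.-integrable setT (EFin \o (F \* g)) -> nu.-integrable setT (EFin \o g).
Proof.
move=> mg /integrableP[_ igF]; apply/integrableP; split.
  exact/measurable_EFinP.
rewrite ge0_integral_density//; last first.
  by apply: measurableT_comp => //; exact/measurable_EFinP.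
apply: le_lt_trans igF; rewrite le_eqVlt; apply/orP; left; apply/eqP.
by apply: eq_integral => x _; rewrite /= normrM EFinM muleC (ger0_norm (F0 x)).
Qed.

(** The nonnegative case is applied to the positive and negative parts of [g]; multiplication by
    [F], being nonnegative, commutes with taking these parts. *)
Lemma Rintegral_density (g : T -> R) : measurable_fun setT g ->
  mu.-integrable setT (EFin \o (F \* g)) ->
  \int[nu]_x g x = \int[mu]_x (F x * g x).
Proof.
move=> mg igF; congr fine; rewrite integralE [in RHS]integralE.
have mge : measurable_fun setT (EFin \o g) by exact/measurable_EFinP.
congr (_ - _)%E.
  rewrite ge0_integral_density//; last exact: measurable_funepos.
  apply: eq_integral => x _; rewrite !funeposE -!EFin_max/= -EFinM mulrC.
  by rewrite maxr_pMr// mulr0.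
rewrite ge0_integral_density//; last exact: measurable_funeneg.
apply: eq_integral => x _; rewrite !funenegE -!EFinN -!EFin_max/= -EFinM mulrC.
by rewrite maxr_pMr// mulr0 mulrN.
Qed.

End density.

(** * Laws that factor on rectangles *)

Section product_law.
Context {d1 d2 : measure_display} {T1 : measurableType d1}
  {T2 : measurableType d2} {R : realType}.
Variables (m1 : probability T1 R) (m2 : probability T2 R)
  (nu : {measure set (T1 * T2) -> \bar R}).
Hypothesis nuM : forall A B, measurable A -> measurable B ->
  nu (A `*` B) = (m1 A * m2 B)%E.


(** Rectangles determine the product measure, hence [nu] coincides with it on all measurable
    sets. *)
Lemma product_law_integral g : (\int[nu]_z g z = \int[(m1 \x m2)]_z g z)%E.
Proof.
by apply: eq_measure_integral => A mA _; apply/esym/product_measure_unique.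
Qed.

Lemma product_law_integrable g :
  nu.-integrable setT g -> (m1 \x m2)%E.-integrable setT g.
Proof.
by move=> /integrableP[mg ig]; apply/integrableP; rewrite -product_law_integral.
Qed.

(** By Tonelli: integrating out the second variable multiplies the absolute value of [u x] by the
    total mass of [m2], which is 1. *)
Lemma product_law_integrable_fst u : measurable_fun setT u ->
  nu.-integrable setT (EFin \o (fun z => u z.1)) ->
  m1.-integrable setT (EFin \o u).
Proof.
move=> mu /product_law_integrable iu.
have := (integrable12ltyP m1 m2 (measurable_int _ iu)).1 iu.
move=> iabs; apply/integrableP; split; first exact/measurable_EFinP.
apply: le_lt_trans iabs; rewrite le_eqVlt; apply/orP; left; apply/eqP.
apply: eq_integral => x _; rewrite /= integral_cst//.
by rewrite [X in (_ * X)%E](@probability_setT _ _ _ m2) mule1.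
Qed.

Lemma product_law_integrable_snd v : measurable_fun setT v ->
  nu.-integrable setT (EFin \o (fun z => v z.2)) ->
  m2.-integrable setT (EFin \o v).
Proof.
move=> mv /product_law_integrable iv.
have := (integrable21ltyP m1 m2 (measurable_int _ iv)).1 iv.
move=> iabs; apply/integrableP; split; first exact/measurable_EFinP.
apply: le_lt_trans iabs; rewrite le_eqVlt; apply/orP; left; apply/eqP.
apply: eq_integral => x _; rewrite /= integral_cst//.
by rewrite [X in (_ * X)%E](@probability_setT _ _ _ m1) mule1.
Qed.

Lemma product_law_Rintegral_tensor u v :
  measurable_fun setT u -> measurable_fun setT v ->
  nu.-integrable setT (EFin \o (fun z => u z.1)) ->
  nu.-integrable setT (EFin \o (fun z => v z.2)) ->
  \int[nu]_z tensor u v z = \int[m1]_x u x * \int[m2]_y v y.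
Proof.
move=> mu mv iu iv; rewrite -Rintegral_tensor.
- by congr fine; exact: product_law_integral.
- exact: product_law_integrable_fst.
- exact: product_law_integrable_snd.
Qed.

End product_law.

(** * Both implications for a law with an expanded density supported in a square *)

Section expansion_of_density.
Context {d : measure_display} {T : measurableType d} {R : realType}.
Variables (mu : {sigma_finite_measure set T -> \bar R}) (D : set T)
  (psi : nat -> T -> R) (c : nat -> nat -> R) (F : T * T -> R)
  (nu : {finite_measure set (T * T)%type -> \bar R}).
Hypothesis mD : measurable D.
Hypothesis muD : (mu D < +oo)%E.
Hypothesis Lpsi : forall k, psi k \in Lfun mu 2%:E.
Hypothesis psi_on : forall j k, inner mu setT (psi j) (psi k) = (j == k)%:R.
Hypothesis LF : F \in Lfun (mu \x mu)%E 2%:E.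
Hypothesis F0 : forall z, 0 <= F z.
Hypothesis FD : forall z, ~ (D `*` D) z -> F z = 0.
Hypothesis nuE : forall A, measurable A ->
  nu A = (\int[(mu \x mu)]_(z in A) (F z)%:E)%E.
Hypothesis Fexp : L2norm (mu \x mu)%E setT (F \- tensor_sum psi c mn.1 mn.2)
  @[mn --> filter_prod \oo \oo] --> (0 : R).

(** [A] itself may have infinite measure; cutting it down to [D] gives a square-integrable
    indicator. *)
Lemma Lfun2_indic A : measurable A -> (\1_(A `&` D) : T -> R) \in Lfun mu 2%:E.
Proof.
move=> mA; have mAD : measurable (A `&` D) by exact: measurableI.
apply: integrable_sqr_Lfun2; first exact: measurable_indic.
apply/integrableP; split.
  by apply/measurable_EFinP/measurable_funX; exact: measurable_indic.
rewrite (eq_integral (fun x => (\1_(A `&` D) x)%:E)); last first.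
  move=> x _ /=; rewrite indicE.
  by case: (_ \in _); rewrite ?expr1n ?expr0n ?normr1 ?normr0.
rewrite integral_indic// setIT; apply: le_lt_trans muD.
by apply: le_measure; rewrite ?inE//; exact: subIsetr.
Qed.

(** [F] vanishes off [D * D]. The product type, in place of a conjunction, lets [rewrite] pick
    whichever equation fits. *)
Lemma mulF_restrict (z : T * T) :
  (F z * \1_D z.1 = F z) * (F z * \1_D z.2 = F z).
Proof.
have [[D1 D2]|nD] := pselect ((D `*` D) z).
  by rewrite !indicE !mem_set// !mulr1.
by rewrite FD// !mul0r.
Qed.

(** Wherever [F] is nonzero, the indicator of the rectangle equals the tensor of the truncated
    indicators. Rectangle masses thus become values of the bilinear form. *)
Lemma law_setX A B : measurable A -> measurable B ->
  nu (A `*` B) =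
  (inner (mu \x mu)%E setT F (tensor \1_(A `&` D) \1_(B `&` D)))%:E.
Proof.
move=> mA mB; rewrite nuE; last exact: measurableX.
have LAB := Lfun2_tensor (Lfun2_indic mA) (Lfun2_indic mB).
rewrite /inner fineK; last first.
  by apply: integrable_fin_num => //; exact: Lfun2_integrableM.
rewrite [LHS]integral_mkcond; apply: eq_integral => z _ /=.
rewrite patchE /tensor; have [[D1 D2]|nD] := pselect ((D `*` D) z); last first.
  by rewrite FD// mul0r; case: ifP.
rewrite in_setX !indicE !in_setI (mem_set D1) (mem_set D2) !andbT.
by do 2 case: (_ \in _); rewrite /= ?mul0r ?mulr0 ?mulr1.
Qed.

(** With [setT] read as the rectangle [setT * setT], this is the minor identity for four indicators.
    [nu setT] stays as a factor since [nu] is only assumed finite. *)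
Lemma rank1_law_product (h g : nat -> R) A B :
  (forall j k, c j k = h j * g k) -> measurable A -> measurable B ->
  (nu (A `*` B) * nu setT = nu (A `*` setT) * nu (setT `*` B))%E.
Proof.
move=> chg mA mB; rewrite -setXTT !law_setX// -!EFinM.
by rewrite (rank1_inner_tensor Lpsi LF Fexp chg) //; exact: Lfun2_indic.
Qed.

Lemma product_law_rank1 (m1 m2 : probability T R) :
  (forall A B, measurable A -> measurable B ->
    nu (A `*` B) = (m1 A * m2 B)%E) ->
  exists h g : nat -> R, forall j k, c j k = h j * g k.
Proof.
(* The witnesses are the expectations of the basis functions under the two marginals. *)
move=> nuM; exists (fun j => \int[m1]_x psi j x), (fun k => \int[m2]_y psi k y).
move=> j k; have mpsi i := Lfun_measurable (Lpsi i).
have mF := Lfun_measurable LF.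
have L1 : (\1_D : T -> R) \in Lfun mu 2%:E.
  by rewrite -[D]setTI; exact: Lfun2_indic.
have LFM u v : u \in Lfun mu 2%:E -> v \in Lfun mu 2%:E ->
    (mu \x mu)%E.-integrable setT (EFin \o (F \* tensor u v)).
  by move=> Lu Lv; exact/Lfun2_integrableM/Lfun2_tensor.
rewrite (expansion_coef Lpsi LF Fexp psi_on).
have mjk := measurable_tensor (mpsi j) (mpsi k).
have ijk := LFM _ _ (Lpsi j) (Lpsi k).
rewrite /inner.
(* The coefficient becomes the expectation of the tensor under [nu]. The alias [sigma_product]
   supplies the sigma-finite structure that the density lemmas require. *)
have <- := @Rintegral_density _ _ _ (sigma_product mu mu) nu F mF F0 nuE
  _ mjk ijk.
apply: product_law_Rintegral_tensor => //.
(* A function of one variable alone need not be square-integrable on the product. Multiplied by [F],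
   it may be tensored with the indicator of [D] without change, and then [F] is paired with an L2
   tensor. *)
- apply: (@integrable_density _ _ _ (sigma_product mu mu) nu F mF F0 nuE).
    exact: measurableT_comp (mpsi j) measurable_fst.
  apply: (eq_integrable _ (EFin \o (F \* tensor (psi j) \1_D))) => //.
    by move=> z _ /=; rewrite /tensor mulrCA mulF_restrict mulrC.
  exact: LFM.
- apply: (@integrable_density _ _ _ (sigma_product mu mu) nu F mF F0 nuE).
    exact: measurableT_comp (mpsi k) measurable_snd.
  apply: (eq_integrable _ (EFin \o (F \* tensor \1_D (psi k)))) => //.
    by move=> z _ /=; rewrite /tensor mulrA mulF_restrict.
  exact: LFM.
Qed.

End expansion_of_density.

(** * Application to the joint law of the two random variables *)

Theorem theorem3p1 (R : realType) (a b : R) (hab : a < b)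
    (phi : nat -> R -> R)
    (phi_on : orthonormal_system lebesgue_measure `[a, b] phi)
    (phi_complete : complete_system lebesgue_measure `[a, b] phi)
    (phi0 : forall x, x \in `[a, b] ->
       phi 0%N x = 1 / L2norm lebesgue_measure `[a, b] (cst 1))
    (d : measure_display) (Omega : measurableType d) (P : probability Omega R)
    (X Y : {RV P >-> R})
    (hX : forall w, X w \in `[a, b]) (hY : forall w, Y w \in `[a, b])
    (f : R * R -> R) (hf : joint_density a b X Y f)
    (c : nat -> nat -> R) (hc : has_expansion a b phi c f) :
  independent_RV X Y <->
  exists h g : nat -> R, forall j k : nat, c j k = h j * g k.
Proof.
pose D : set (measurableTypeR R) := `[a, b]%classic.
pose psi k : measurableTypeR R -> R := phi k \_ D.
pose F := f \_ (D `*` D).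
have [mf f0 hPf] := hf; have [Lf hlim] := hc; have [Lphi on] := phi_on.
have mD : measurable D by exact: measurable_itv.
have muD : (@lebesgue_measure R D < +oo)%E.
  by rewrite lebesgue_measure_itv; case: ifP => _ //=; rewrite -EFinB ltry.
have psi_on j k :
    inner (@lebesgue_measure R) setT (psi j) (psi k) = (j == k)%:R.
  by rewrite -inner_restrict on.
have F0 z : 0 <= F z by rewrite /F patchE; case: ifPn => // /set_mem /f0.
have FD z : ~ (D `*` D) z -> F z = 0 by move=> nz; rewrite /F patchE memNset.
(* Off the square, [F] and every tensor of the extended basis functions vanish, so the norm over the
   whole plane equals the one over the square. *)
have Fexp : L2norm lebesgue2 setT (F \- tensor_sum psi c mn.1 mn.2)
    @[mn --> filter_prod \oo \oo] --> (0 : R).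
  apply: cvg_trans hlim; apply: near_eq_cvg; apply: nearW => -[m n] /=.
  rewrite L2norm_restrict; congr (L2norm _ _ _); apply/funext => z /=.
  rewrite /F patchE; case: ifPn => [/set_mem[D1 D2]|/negP zD].
    rewrite !patchE mem_set//; congr (_ - _); apply: eq_bigr => j _.
    by apply: eq_bigr => k _; rewrite /tensor /psi !patchE !mem_set.
  rewrite !patchE (negbTE (introN idP zD)) sub0r; apply/esym/eqP.
  rewrite oppr_eq0 /tensor_sum big1// => j _; rewrite big1// => k _.
  rewrite /tensor /psi !patchE.
  case: ifPn => [/set_mem D1|]; last by rewrite mul0r mulr0.
  case: ifPn => [/set_mem D2|]; last by rewrite !mulr0.
  by case: zD; apply: mem_set.
have mX : measurable_fun setT (X : Omega -> measurableTypeR R).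
  exact: (measurable_funPT X).
have mY : measurable_fun setT (Y : Omega -> measurableTypeR R).
  exact: (measurable_funPT Y).
(* [X] and [Y] are repackaged with the display on which Lebesgue measure lives; [Z] is the pair, and
   its distribution plays the role of [nu]. *)
pose X' : {mfun Omega >-> measurableTypeR R} :=
  @mfun_Sub _ _ _ (measurableTypeR R) X (mem_set mX).
pose Y' : {mfun Omega >-> measurableTypeR R} :=
  @mfun_Sub _ _ _ (measurableTypeR R) Y (mem_set mY).
pose Z : {mfun Omega >-> (measurableTypeR R * measurableTypeR R)%type} :=
  @mfun_Sub _ _ _ _ _ (mem_set (measurable_fun_pair mX mY)).
have nuE A : measurable A ->
    distribution P Z A = (\int[lebesgue2]_(z in A) (F z)%:E)%E.
  move=> mA; rewrite [LHS](hPf A mA) integral_mkcondr.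
  by apply: eq_integral => z _; rewrite restrict_EFin.
split => [XY|[h [g chg]] A B mA mB].
  apply: (product_law_rank1 mD muD Lphi psi_on Lf F0 FD nuE Fexp
    (m1 := distribution P X') (m2 := distribution P Y')).
  (* The preimage of a rectangle under [Z] is convertible to the intersection of the two
     preimages. *)
  by move=> A B mA mB; exact: XY.
have := rank1_law_product mD muD Lphi Lf FD nuE Fexp chg mA mB.
(* The law of [Z] has total mass 1, which removes the extra factor. *)
rewrite [X in (_ * X)%E = _](_ : _ = 1%E) ?mule1; last exact: probability_setT.
move=> nuAB.
have nuA : distribution P Z (A `*` setT) = P (X @^-1` A).
  by congr (P _); apply/seteqP; split=> [w []|w] //.
have nuB : distribution P Z (setT `*` B) = P (Y @^-1` B).
  by congr (P _); apply/seteqP; split=> [w []|w] //.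
by rewrite -nuA -nuB; exact: nuAB.
Qed.
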